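(* Let $k\subset K$ be a field extension, $A\subset M_n(K)$ a $k$-algebra, and $S\subset K^n$ a simple $K\otimes_kA$-module with $\dim_KS=m$ such that $K^n=S^{\oplus l}$ as $K\otimes_kA$-modules. For $1\le i\le l$, $\Phi_i:h_{\operatorname{Spec}B}\to F_A(m,n)$ is an open subfunctor. Furthermore, if $K$ is infinite and $A$ is commutative, then $\Phi_i:h_{\operatorname{Spec}B}\to H_A(m,n)$ is an open subfunctor.
   Context: Elements of $R^n$ ($R$ a commutative $K$-algebra) are row vectors; $R\otimes_kA$ acts on $R^n$ by $(r\otimes a)\cdot x=r\,xa$. A submodule $M\subset R^n$ is $A$-invariant if it is an $R\otimes_kA$-submodule. Coordinates are chosen compatibly with $K^n=S^{\oplus l}$, so that $n=lm$ and the $i$-th copy of $S$ is given by coordinates $(i-1)m+1,\dots,im$. $G(m,n)(R)$ is the set of free rank $m$ direct summands of $R^n$, functorial by pullback (for $\delta:R\to T$, $M$ goes to the image of $T\otimes_RM$ in $T^n$). $F_A(m,n)(R)\subset G(m,n)(R)$ is the subset of $A$-invariant $M$. $M\in G(m,n)(R)$ is generated by $A$-invariants if the image of $\bigwedge^mM$ in $\bigwedge^mR^n\cong R\otimes_K\bigwedge^mK^n$ has an $R$-module generator of the form $\sum_ir_i\otimes v_{i1}\wedge\cdots\wedge v_{im}$ where each $\{v_{i1},\dots,v_{im}\}$ is a basis of a rank $m$ $A$-invariant subspace of $K^n$; $G_A(m,n)(R)$ is the set of such $M$, and $H_A(m,n)(R)=F_A(m,n)(R)\cap G_A(m,n)(R)$.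 Let $B=K[x_1,\dots,x_{lm-m}]$ and $h_{\operatorname{Spec}B}(R)=\operatorname{Hom}_{K\text{-}\mathsf{alg}}(B,R)$. For $1\le i\le l$, $\Phi_i:h_{\operatorname{Spec}B}\to F_A(m,n)$ is the natural transformation sending $\psi:B\to R$ to the $R\otimes_kA$-submodule of $R^{lm}$ generated by $$(\psi(x_1),\dots,\psi(x_{(i-1)m}),1,0,\dots,0,\psi(x_{(i-1)m+1}),\dots,\psi(x_{lm-m})),$$ where $1,0,\dots,0$ occupy coordinates $(i-1)m+1,\dots,im$. If $K$ is infinite and $A$ is commutative, $\Phi_i$ takes values in $H_A(m,n)$, and the resulting transformation $h_{\operatorname{Spec}B}\to H_A(m,n)$ is also denoted $\Phi_i$. A subfunctor $\Phi:h_{\operatorname{Spec}B}\to X$ is open if for every commutative $K$-algebra $R$ and natural transformation $h_{\operatorname{Spec}R}\to X$, the projection $h_{\operatorname{Spec}B}\times_Xh_{\operatorname{Spec}R}\to h_{\operatorname{Spec}R}$ corresponds to the inclusion of an open subscheme of $\operatorname{Spec}R$; equivalently, there is an ideal $I\subset R$ such that, for every $K$-algebra $T$, its image on $T$-points is $\{\delta:R\to T\mid\delta(I)T=T\}$.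
   Formalization: For noncommutative A the submodule defining Φ_i need not lie in F_A(m,n) (e.g. A=M_2(K) diagonal in M_4(K)), so the first claim is stated assuming A is commutative or that Φ_i takes values in F_A(m,n); for commutative A this is proved. *)

(* Defs.v *)
From HB Require Import structures.
From mathcomp Require Import all_boot all_order all_algebra.
From mathcomp.multinomials Require Import mpoly.

Set Implicit Arguments.
Unset Strict Implicit.
Unset Printing Implicit Defensive.

Import GRing.Theory.
Local Open Scope ring_scope.

(* Commutative K-algebras.  MathComp's comAlgType excludes the zero algebra,
   which is an object of the category considered here. *)
Record kalgebra (K : fieldType) := KAlgebra {
  kalg_ring :> comPzRingType;
  kalg_scalar : {rmorphism K -> kalg_ring}
}.

Record khom (K : fieldType) (R T : kalgebra K) := KHom {
  khom_fun :> {rmorphism R -> T};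
  khom_scalar : forall c : K, khom_fun (kalg_scalar R c) = kalg_scalar T c
}.

Program Definition khom_comp (K : fieldType) (R T U : kalgebra K)
    (g : khom T U) (f : khom R T) : khom R U :=
  @KHom K R U (GRing.RMorphism.clone _ _ (g \o f) _) _.
Next Obligation. by rewrite !khom_scalar. Qed.

Definition polynomial_algebra (K : fieldType) (N : nat) : kalgebra K :=
  @KAlgebra K {mpoly K[N]} (GRing.RMorphism.clone _ _ (@mpolyC N K) _).

(* The j-th variable (counted from 0) of K[x_1, ..., x_N]; junk for j >= N. *)
Definition polyvar (K : fieldType) (N j : nat) : {mpoly K[N]} :=
  if insub j is Some u then 'X_u else 0.

Section Submodules.

Variables (K : fieldType) (n : nat).

(* Subsets of R^n; in use they are R-submodules, compared extensionally. *)
Definition vset (R : kalgebra K) := 'rV[R]_n -> Prop.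

Definition eq_vset (R : kalgebra K) (M N : vset R) := forall x, M x <-> N x.

Definition is_submodule (R : kalgebra K) (M : vset R) : Prop :=
  [/\ M 0,
      (forall x y, M x -> M y -> M (x + y)) &
      (forall (r : R) x, M x -> M (r *: x))].

(* The image of T (x)_R M in T^n. *)
Definition pullback (R T : kalgebra K) (f : khom R T) (M : vset R) : vset T :=
  fun y => exists p (t : 'I_p -> T) (x : 'I_p -> 'rV[R]_n),
    (forall j, M (x j)) /\ y = \sum_(j < p) t j *: map_mx f (x j).

Definition scalar_mx_ext (R : kalgebra K) (p q : nat) (a : 'M[K]_(p, q)) :
  'M[R]_(p, q) := map_mx (kalg_scalar R) a.

Definition invariant (A : 'M[K]_n -> Prop) (R : kalgebra K) (M : vset R) :=
  forall a x, A a -> M x -> M (x *m scalar_mx_ext R a).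

(* The R (x)_k A-submodule of R^n generated by v. *)
Definition generated (A : 'M[K]_n -> Prop) (R : kalgebra K) (v : 'rV[R]_n) :
  vset R :=
  fun x => forall M : vset R,
    is_submodule M -> invariant A M -> M v -> M x.

Definition free_of_rank (m : nat) (R : kalgebra K) (M : vset R) : Prop :=
  exists b : 'M[R]_(m, n),
    (forall x, M x <-> exists c : 'rV[R]_m, x = c *m b) /\
    (forall c : 'rV[R]_m, c *m b = 0 -> c = 0).

Definition direct_summand (R : kalgebra K) (M : vset R) : Prop :=
  exists N : vset R,
    [/\ is_submodule N,
        (forall x, exists y z, [/\ M y, N z & x = y + z]) &
        (forall x, M x -> N x -> x = 0)].

(* Functors R |-> {certain submodules of R^n}; the action on morphisms is
   always [pullback]. *)
Definition submodule_functor := forall R : kalgebra K, vset R -> Prop.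

Definition grassmannian (m : nat) : submodule_functor := fun R M =>
  [/\ is_submodule M, free_of_rank m M & direct_summand M].

Definition F_ (A : 'M[K]_n -> Prop) (m : nat) : submodule_functor :=
  fun R M => grassmannian m M /\ invariant A M.

(* Strictly increasing maps 'I_m -> 'I_n: they index the standard basis
   e_{J 0} /\ ... /\ e_{J (m-1)} of the m-th exterior power of R^n. *)
Definition increasing (m : nat) :=
  {J : {ffun 'I_m -> 'I_n} |
    [forall i : 'I_m, forall j : 'I_m, (i < j)%N ==> (J i < J j)%N]}.

(* The exterior product of the rows of x, as its coordinates in that basis.
   This model is compatible with the identification of the m-th exterior power
   of R^n with R (x)_K (the m-th exterior power of K^n). *)
Definition wedge (m : nat) (R : kalgebra K) (x : 'M[R]_(m, n))
  (J : increasing m) : R := \det (colsub (val J) x).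

Definition in_wedge_image (m : nat) (R : kalgebra K) (M : vset R)
    (w : increasing m -> R) : Prop :=
  exists p (r : 'I_p -> R) (x : 'I_p -> 'M[R]_(m, n)),
    (forall j h, M (row h (x j))) /\
    (forall J, w J = \sum_(j < p) r j * wedge (x j) J).

Definition invariant_basis (A : 'M[K]_n -> Prop) (m : nat)
    (v : 'M[K]_(m, n)) : Prop :=
  row_free v /\ forall a, A a -> stablemx v a.

Definition generated_by_invariants (A : 'M[K]_n -> Prop) (m : nat)
    (R : kalgebra K) (M : vset R) : Prop :=
  exists p (r : 'I_p -> R) (v : 'I_p -> 'M[K]_(m, n)),
    (forall j, invariant_basis A (v j)) /\
    (forall w : increasing m -> R,
      in_wedge_image M w <->
      exists c : R, forall J,
        w J = c * \sum_(j < p) r j * wedge (scalar_mx_ext R (v j)) J).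

Definition G_ (A : 'M[K]_n -> Prop) (m : nat) : submodule_functor :=
  fun R M => grassmannian m M /\ generated_by_invariants A m M.

Definition H_ (A : 'M[K]_n -> Prop) (m : nat) : submodule_functor :=
  fun R M => F_ A m M /\ G_ A m M.

Definition natural_transformation (R : kalgebra K) (X : submodule_functor)
    (eta : forall T : kalgebra K, khom R T -> vset T) : Prop :=
  (forall T (d : khom R T), X T (eta T d)) /\
  (forall T U (d : khom R T) (g : khom T U),
    eq_vset (eta U (khom_comp g d)) (pullback g (eta T d))).

Definition is_ideal (R : kalgebra K) (I : R -> Prop) : Prop :=
  [/\ I 0,
      (forall a b, I a -> I b -> I (a + b)) &
      (forall r a, I a -> I (r * a))].

(* d(I)T = T *)
Definition extends_to_unit_ideal (R T : kalgebra K) (d : khom R T)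
    (I : R -> Prop) : Prop :=
  forall y : T, exists p (t : 'I_p -> T) (a : 'I_p -> R),
    (forall j, I (a j)) /\ y = \sum_(j < p) t j * d (a j).

(* Phi : h_{Spec B} -> X is a monomorphism whose pullback along any
   h_{Spec R} -> X is the open subscheme of Spec R defined by an ideal. *)
Definition open_subfunctor (B : kalgebra K) (X : submodule_functor)
    (Phi : forall R : kalgebra K, khom B R -> vset R) : Prop :=
  [/\ natural_transformation X Phi,
      (forall R (psi psi' : khom B R),
        eq_vset (Phi R psi) (Phi R psi') -> psi =1 psi') &
      (forall (R : kalgebra K) (eta : forall T : kalgebra K, khom R T -> vset T),
        natural_transformation X eta ->
        exists I : R -> Prop, is_ideal I /\
          forall T (d : khom R T),
            (exists psi : khom B T, eq_vset (Phi T psi) (eta T d)) <->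
            extends_to_unit_ideal d I)].

End Submodules.

Section MatrixAlgebras.

Variables (k K : fieldType) (iota : {rmorphism k -> K}) (n : nat).

Definition is_subalgebra (A : 'M[K]_n -> Prop) : Prop :=
  [/\ A 1%:M,
      (forall a b, A a -> A b -> A (a + b)),
      (forall a b, A a -> A b -> A (a *m b)) &
      (forall (c : k) a, A a -> A (iota c *: a))].

End MatrixAlgebras.

Definition is_commutative (K : fieldType) (n : nat) (A : 'M[K]_n -> Prop) :=
  forall a b, A a -> A b -> a *m b = b *m a.

Definition is_infinite (K : fieldType) := forall s : seq K, exists x, x \notin s.

(* Subspaces of K^n are row spaces.  The row space of S is a simple
   K (x)_k A-submodule of K^n. *)
Definition is_simple (K : fieldType) (n : nat) (A : 'M[K]_n -> Prop)
    (S : 'M[K]_n) : Prop :=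
  [/\ (forall a, A a -> stablemx S a),
      S != 0 &
      (forall U : 'M[K]_n, (forall a, A a -> stablemx U a) ->
        (U <= S)%MS -> U != 0 -> (S <= U)%MS)].

(* The subspace of K^(lm) of vectors supported on the i-th block of m
   coordinates. *)
Definition coordinate_block (K : fieldType) (l m : nat) (i : 'I_l) :
  'M[K]_(m, l * m) :=
  \matrix_(j < m, c < l * m) (c == i * m + j :> nat)%N%:R.

(* K^(lm) is a direct sum of l copies of S, the i-th one being the i-th
   coordinate block: f restricts to an A-linear isomorphism from S onto it. *)
Definition is_coordinate_sum_of_copies (K : fieldType) (l m : nat)
    (A : 'M[K]_(l * m) -> Prop) (S : 'M[K]_(l * m)) : Prop :=
  forall i : 'I_l, exists f : 'M[K]_(l * m),
    [/\ f \in unitmx,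
        (forall a, A a -> S *m a *m f = S *m f *m a) &
        (S *m f == coordinate_block K m i)%MS].

Definition Phi_vector (K : fieldType) (l m : nat) (i : 'I_l) (R : kalgebra K)
    (psi : khom (polynomial_algebra K (l * m - m)) R) : 'rV[R]_(l * m) :=
  \row_(c < l * m)
    if (c %/ m == i)%N then (c %% m == 0)%N%:R
    else psi (polyvar K (l * m - m) (if (c < i * m)%N then c : nat else (c - m)%N)).

Definition Phi_ (K : fieldType) (l m : nat) (A : 'M[K]_(l * m) -> Prop)
    (i : 'I_l) (R : kalgebra K)
    (psi : khom (polynomial_algebra K (l * m - m)) R) : vset (l * m) R :=
  generated A (Phi_vector i psi).

(* Main.v *)
(* An element of A acts on R^(lm) block-diagonally, and the first basis vector of block i
   generates that block over K (x) A because S is simple.  Hence an invariant rank m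
   summand M of R^(lm) has the form Phi_i(psi) exactly when it projects isomorphically onto block i,
   psi being read off the unique vector of M with block i equal to (1, 0, ..., 0).  If the
   rows of b form a basis of M, this locus is the nonvanishing of the determinant of block
   i of b, which is the principal ideal sought.

   If A is commutative, K-combinations of A act faithfully on block i, so that elements
   a_1, ..., a_m of A taking the first basis vector to a basis of block i span A over K;
   the submodule generated by v then has basis v a_1, ..., v a_m.  Its exterior product is
   a polynomial of degree at most m in each coordinate of v, so over an infinite field
   Lagrange interpolation writes it as an R-combination of its values at K-points of
   the affine space, and these are exterior products of invariant bases. *)

Require Import Defs.
From HB Require Import structures.
From mathcomp Require Import all_boot all_order all_algebra.
From mathcomp.multinomials Require Import mpoly.
From Stdlib Require Import Classical FunctionalExtensionality.
Set Implicit Arguments.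
Unset Strict Implicit.
Unset Printing Implicit Defensive.
Import GRing.Theory.
Local Open Scope ring_scope.

(** * Morphisms of K-algebras and evaluation of polynomials *)

Lemma rmorphism_eq (R T : pzRingType) (f g : {rmorphism R -> T}) :
  f =1 g -> f = g.
Proof.
move=> /functional_extensionality; case: f => f [[f0] [f1]]; case: g => g [[g0] [g1]] /= e.
subst g; rewrite (proof_irrelevance _ g0 f0) (proof_irrelevance _ g1 f1) //.
Qed.

(** The families [eta] take morphisms as arguments, so pointwise equal morphisms have to be
    identified by Leibniz equality. *)
Lemma khom_eq (K : fieldType) (R T : kalgebra K) (f g : khom R T) :
  f =1 g -> f = g.
Proof.
case: f g => [f fK] [g gK] /= /rmorphism_eq fg; subst g.
by rewrite (proof_irrelevance _ gK fK).
Qed.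

Lemma mpoly_eval_exists (K : fieldType) (N : nat) (T : kalgebra K) (h : 'I_N -> T) :
  exists psi : khom (polynomial_algebra K N) T, forall j, psi 'X_j = h j.
Proof.
(* [mmap] evaluates in a nonzero ring; in the zero algebra the constant map is the morphism
   sought. *)
case: (eqVneq (1 : T) 0) => [T0|T_neq0].
- have T_eq (x y : T) : x = y by rewrite -[x]mul1r -[y]mul1r T0 !mul0r.
  have f_add : zmod_morphism (fun _ : {mpoly K[N]} => 0 : T) by move=> x y; exact: T_eq.
  have f_mul : monoid_morphism (fun _ : {mpoly K[N]} => 0 : T) by split => [|x y]; exact: T_eq.
  pose fA := GRing.isZmodMorphism.Build _ _ (fun _ : {mpoly K[N]} => 0 : T) f_add.
  pose fM := GRing.isMonoidMorphism.Build _ _ (fun _ : {mpoly K[N]} => 0 : T) f_mul.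
  pose f : {rmorphism {mpoly K[N]} -> T} := HB.pack (fun _ : {mpoly K[N]} => 0 : T) fA fM.
  have fK c : f (kalg_scalar (polynomial_algebra K N) c) = kalg_scalar T c by exact: T_eq.
  by exists (@KHom K (polynomial_algebra K N) T f fK) => j; exact: T_eq.
pose nz := GRing.PzSemiRing_isNonZero.Build T T_neq0.
pose T' : comNzRingType := HB.pack (GRing.ComPzRing.sort T) (GRing.ComPzRing.class T) nz.
pose f : {rmorphism K -> T'} := kalg_scalar T.
pose g : {rmorphism {mpoly K[N]} -> T'} := mmap f h.
have gK c : g (kalg_scalar (polynomial_algebra K N) c) = kalg_scalar T c.
  exact: mmapC.
exists (@KHom K (polynomial_algebra K N) T g gK) => j.
by rewrite /= mmapX mmap1U.
Qed.

Lemma khom_mpoly_eq (K : fieldType) (N : nat) (T : kalgebra K)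
    (f g : khom (polynomial_algebra K N) T) :
  (forall j, f 'X_j = g 'X_j) -> f =1 g.
Proof.
move=> fg p; have /= -> : p = \sum_(m <- msupp p) (p@_m)%:MP * 'X_[m].
  by rewrite {1}[p]mpolyE; apply: eq_bigr => m _; rewrite mul_mpolyC.
rewrite !(raddf_sum, rmorph_sum) /=; apply: eq_bigr => m _; rewrite !rmorphM mpolyXE_id.
congr (_ * _); first by rewrite (khom_scalar f) (khom_scalar g).
by rewrite !rmorph_prod; apply: eq_bigr => j _; rewrite !rmorphXn fg.
Qed.

(** * Coordinate blocks of K^(lm) *)

Section Blocks.
Variables (K : fieldType) (l m : nat).
Implicit Types (i j : 'I_l) (h : 'I_m) (R : kalgebra K).

Lemma block_index_proof i h : (i * m + h < l * m)%N.
Proof.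
by apply: (@leq_trans (i.+1 * m)); rewrite ?leq_mul2r ?ltn_ord ?orbT // mulSn addnC ltn_add2r.
Qed.

Definition block_index i h : 'I_(l * m) := Ordinal (block_index_proof i h).

Lemma block_index_div i h : (block_index i h %/ m)%N = i.
Proof.
have m_gt0 : (0 < m)%N by apply: leq_ltn_trans (ltn_ord h).
by rewrite /= divnMDl // divn_small ?addn0.
Qed.

Lemma block_index_mod i h : (block_index i h %% m)%N = h.
Proof. by rewrite /= modnMDl modn_small. Qed.

Lemma block_indexP (c : 'I_(l * m)) : exists i h, c = block_index i h.
Proof.
have m_gt0 : (0 < m)%N by case: m c => [[c]|//]; rewrite muln0.
have c_div : (c %/ m < l)%N by rewrite ltn_divLR.
exists (Ordinal c_div), (Ordinal (ltn_pmod c m_gt0)); apply: val_inj.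
by rewrite /= -divn_eq.
Qed.

Lemma coordinate_blockE i : coordinate_block K m i = rowsub (block_index i) 1%:M.
Proof. by apply/matrixP => h c; rewrite !mxE eq_sym. Qed.

Lemma mul_coordinate_block_tr R p (x : 'M[R]_(p, l * m)) i :
  x *m scalar_mx_ext R (coordinate_block K m i)^T = colsub (block_index i) x.
Proof.
apply/matrixP => r h; rewrite !mxE (bigD1 (block_index i h)) //= big1 => [|c].
  by rewrite !mxE eqxx rmorph1 mulr1 addr0.
by rewrite !mxE -val_eqE /= => /negPf ->; rewrite rmorph0 mulr0.
Qed.

(** With the next two lemmas: the blocks and their transposes are the inclusions and projections of
    a direct sum decomposition. *)
Lemma coordinate_block_orthonormal i :
  coordinate_block K m i *m (coordinate_block K m i)^T = 1%:M.
Proof.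
rewrite {1}coordinate_blockE mul_rowsub_mx mul1mx.
by apply/matrixP => h h'; rewrite !mxE eqn_add2l.
Qed.

Lemma coordinate_block_orthogonal i j : i != j ->
  coordinate_block K m i *m (coordinate_block K m j)^T = 0.
Proof.
move=> ij; rewrite {1}coordinate_blockE mul_rowsub_mx mul1mx.
apply/matrixP => h h'; rewrite !mxE; case: eqP => // e; case/eqP: ij; apply: val_inj => /=.
by rewrite -(block_index_div i h) -(block_index_div j h') /= -e.
Qed.

Lemma sum_coordinate_block :
  \sum_(i < l) (coordinate_block K m i)^T *m coordinate_block K m i = 1%:M.
Proof.
apply/matrixP => c c'; rewrite summxE.
have [i [h ->]] := block_indexP c.
rewrite (bigD1 i) //= big1 => [|j ji]; rewrite !mxE ?addr0.
  rewrite (bigD1 h) //= big1 => [|h' hh']; rewrite !mxE /=.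
    by rewrite eqxx mul1r addr0 -val_eqE /= eq_sym.
  by rewrite eqn_add2l val_eqE eq_sym (negPf hh') mul0r.
apply: big1 => h' _; rewrite !mxE /= -[LHS]/((_ == _)%:R * _).
case: eqP => [e|]; last by rewrite mul0r.
case/eqP: ji; apply: val_inj => /=.
by rewrite -(block_index_div i h) -(block_index_div j h') /= -e.
Qed.

End Blocks.

(** * Action of block-stable matrices on one block *)

Section BlockAction.
Variables (K : fieldType) (l m : nat) (i : 'I_l).

Definition block_action (a : 'M[K]_(l * m)) : 'M[K]_m :=
  coordinate_block K m i *m a *m (coordinate_block K m i)^T.

Lemma block_action_is_linear : linear block_action.
Proof. by move=> c a b; rewrite /block_action mulmxDr mulmxDl -scalemxAr -scalemxAl. Qed.

HB.instance Definition _ :=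
  GRing.isLinear.Build K 'M[K]_(l * m) 'M[K]_m _ block_action block_action_is_linear.

Lemma stable_block_mul (a : 'M[K]_(l * m)) :
  stablemx (coordinate_block K m i) a ->
  coordinate_block K m i *m a = block_action a *m coordinate_block K m i.
Proof.
move=> /submxP [D aD]; rewrite /block_action aD -(mulmxA D).
by rewrite coordinate_block_orthonormal mulmx1.
Qed.

(** Insert the decomposition of the identity to the left of [a]: stability kills the terms from
    blocks j other than i. *)
Lemma block_diagonal_mul (a : 'M[K]_(l * m)) :
  (forall j, stablemx (coordinate_block K m j) a) ->
  a *m (coordinate_block K m i)^T = (coordinate_block K m i)^T *m block_action a.
Proof.
move=> a_stable; rewrite -[a in LHS]mul1mx -(sum_coordinate_block K l m) !mulmx_suml.
rewrite (bigD1 i) //= big1 ?addr0 => [|j ji]; first by rewrite /block_action !mulmxA.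
have /submxP [D aD] := a_stable j.
by rewrite -(mulmxA _ _ a) aD -!mulmxA coordinate_block_orthogonal // !mulmx0.
Qed.

Lemma block_actionM (a b : 'M[K]_(l * m)) :
  stablemx (coordinate_block K m i) a ->
  block_action (a *m b) = block_action a *m block_action b.
Proof.
move=> /stable_block_mul aE.
by rewrite [LHS]/block_action (mulmxA _ a) aE -!mulmxA (mulmxA _ b).
Qed.

Lemma ext_block_mul (R : kalgebra K) p (x : 'M[R]_(p, l * m)) (a : 'M[K]_(l * m)) :
  (forall j, stablemx (coordinate_block K m j) a) ->
  colsub (block_index i) (x *m scalar_mx_ext R a) =
  colsub (block_index i) x *m scalar_mx_ext R (block_action a).
Proof.
move=> a_stable; rewrite -!mul_coordinate_block_tr -!mulmxA; congr (_ *m _).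
by rewrite -!map_mxM block_diagonal_mul.
Qed.

End BlockAction.

(** * Consequences of the simplicity of S *)

Section SimpleModule.
Variables (k K : fieldType) (iota : {rmorphism k -> K}) (l m : nat).
Variables (A : 'M[K]_(l * m) -> Prop) (S : 'M[K]_(l * m)).
Hypotheses (A_alg : is_subalgebra iota A) (S_simple : is_simple A S).
Hypothesis S_copies : @is_coordinate_sum_of_copies K l m A S.

Lemma coordinate_block_stable a (j : 'I_l) :
  A a -> stablemx (coordinate_block K m j) a.
Proof.
case: S_simple => S_stable _ _ Aa; have [f [_ fA /eqmxP SfE]] := S_copies j.
by rewrite -(eqmxMr a SfE) -SfE -fA // submxMr // S_stable.
Qed.

(** Block i is a simple module: its isomorphism with S carries U back to a nonzero submodule V of S,
    and minimality of S gives V = S. *)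
Lemma simple_block_full (i : 'I_l) q (U : 'M[K]_(q, m)) :
  (forall a, A a -> stablemx U (block_action i a)) -> U != 0 -> row_full U.
Proof.
move=> U_stable U_neq0; have [f [f_unit fA /eqmxP SfE]] := S_copies i.
have [_ _ S_min] := S_simple.
pose E := coordinate_block K m i; rewrite -/E in SfE.
pose V := U *m E *m invmx f.
have VfE : V *m f = U *m E by rewrite mulmxKV.
have V_sub : (V <= S)%MS.
  by rewrite -[S in (_ <= S)%MS](mulmxK f_unit) submxMr // SfE submxMl.
have V_neq0 : V != 0.
  apply: contra U_neq0 => /eqP V0; apply/eqP.
  by rewrite -[U]mulmx1 -(coordinate_block_orthonormal K m i) mulmxA -/E -VfE V0 !mul0mx.
have V_stable a : A a -> stablemx V a.
  move=> Aa; have /submxP [D VE] := V_sub.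
  rewrite -[V *m a](mulmxK f_unit) submxMr //.
  have -> : V *m a *m f = V *m f *m a by rewrite VE -!mulmxA (mulmxA S) fA // !mulmxA.
  rewrite VfE -mulmxA stable_block_mul; last exact: coordinate_block_stable.
  by rewrite mulmxA submxMr // U_stable.
have S_sub : (S <= V)%MS.
  (* [is_simple] tests square matrices only, so V is replaced by a square matrix with the same row
     space. *)
  rewrite -(genmxE V); apply: S_min => [a Aa||].
  - by rewrite (eqmxMr a (genmxE V)) genmxE V_stable.
  - by rewrite genmxE.
  - by rewrite -mxrank_eq0 genmxE mxrank_eq0.
have: (E <= U *m E)%MS by rewrite -SfE -VfE submxMr.
move=> /(submxMr E^T).
by rewrite -mulmxA coordinate_block_orthonormal mulmx1 sub1mx.
Qed.

(** Induction on r. If no a0 enlarged the span V of the vectors found so far, V would be stable, and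
    nonzero because it contains e = e 1; by simplicity it would be the whole block, of dimension m >
    r. *)
Lemma orbit_rank (i : 'I_l) (e : 'rV[K]_m) r : e != 0 -> (r <= m)%N ->
  exists a : 'I_r -> 'M[K]_(l * m), (forall h, A (a h)) /\
    (r <= \rank (\matrix_h (e *m block_action i (a h))))%N.
Proof.
have [A1 _ AM _] := A_alg.
move=> e_neq0; elim: r => [|r IHr] r_lt; first by exists (fun=> 0); split => [[]|].
have {IHr} [a [Aa a_rank]] := IHr (ltnW r_lt).
pose V := \matrix_h (e *m block_action i (a h)); rewrite -/V in a_rank.
have [a0 [Aa0 a0V]] : exists a0, A a0 /\ ~~ (e *m block_action i a0 <= V)%MS.
  apply: NNPP => none.
  have sub_V a0 : A a0 -> (e *m block_action i a0 <= V)%MS.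
    by move=> Aa0; apply/negPn/negP => a0V; apply: none; exists a0.
  have: row_full V.
    apply: (@simple_block_full i) => [b Ab|].
      apply/row_subP => h; rewrite row_mul rowK -mulmxA -block_actionM.
        by apply: sub_V; exact: AM.
      exact: coordinate_block_stable.
    apply: contra e_neq0 => /eqP V0; have := sub_V _ A1.
    rewrite /block_action mulmx1 coordinate_block_orthonormal mulmx1 V0.
    by move=> /submxP [D ->]; rewrite mulmx0.
  rewrite /row_full => /eqP V_full.
  by have := leq_trans r_lt (eq_leq (esym V_full)); rewrite ltnNge rank_leq_row.
exists (fun h => if unlift ord0 h is Some h' then a h' else a0).
split=> [h|]; first by case: unliftP => [h' _|_].
set W := \matrix_h _.
have V_sub : (V <= W)%MS.
  apply/row_subP => h; have -> : row h V = row (lift ord0 h) W.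
    by rewrite !rowK liftK.
  exact: row_sub.
have: (V < W)%MS.
  rewrite ltmxE V_sub; apply: contra a0V => /(submx_trans _); apply.
  have -> : e *m block_action i a0 = row ord0 W by rewrite rowK unlift_none.
  exact: row_sub.
by move=> /rank_ltmx; apply: leq_ltn_trans.
Qed.

Lemma orbit_basis (i : 'I_l) (e : 'rV[K]_m) : e != 0 ->
  exists a : 'I_m -> 'M[K]_(l * m), (forall h, A (a h)) /\
    (\matrix_h (e *m block_action i (a h))) \in unitmx.
Proof.
move=> /(orbit_rank i) /(_ (leqnn m)) [a [Aa a_rank]]; exists a; split=> //.
by rewrite -row_full_unit /row_full eqn_leq rank_leq_row.
Qed.

(* The blocks are isomorphic [A]-modules, so the action on one of them is faithful. *)
Lemma block_action_faithful (i : 'I_l) a p (c : 'I_p -> K) (b : 'I_p -> 'M[K]_(l * m)) :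
  A a -> (forall h, A (b h)) ->
  block_action i a = \sum_h c h *: block_action i (b h) ->
  a = \sum_h c h *: b h.
Proof.
move=> Aa Ab; set z := \sum_h c h *: b h => aE.
have mul_z q r (x : 'M_(q, _)) (y : 'M_(_, r)) :
    x *m z *m y = \sum_h c h *: (x *m b h *m y).
  by rewrite mulmx_sumr mulmx_suml; apply: eq_bigr => h _; rewrite -scalemxAr -scalemxAl.
(* z is a K-combination of elements of A, possibly outside A, so the A-linearity of f is first
   extended to it. *)
have S_z f : f \in unitmx -> (forall x, A x -> S *m x *m f = S *m f *m x) ->
    S *m z *m f = S *m f *m z.
  move=> f_unit fA; rewrite mul_z -[RHS]mulmx1 mul_z.
  by apply: eq_bigr => h _; rewrite mulmx1 fA.
have E_eq : coordinate_block K m i *m a = coordinate_block K m i *m z.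
  rewrite stable_block_mul ?coordinate_block_stable // aE mulmx_suml -[RHS]mulmx1 mul_z.
  apply: eq_bigr => h _; rewrite mulmx1 -scalemxAl stable_block_mul //.
  exact: coordinate_block_stable.
have Sa : S *m a = S *m z.
  have [f [f_unit fA /eqmxP SfE]] := S_copies i.
  apply: (can_inj (mulmxK f_unit)); rewrite fA // S_z //.
  have /submxP [D ->] : (S *m f <= coordinate_block K m i)%MS by rewrite SfE.
  by rewrite -!mulmxA E_eq.
rewrite -[a]mul1mx -[z]mul1mx -(sum_coordinate_block K l m) !mulmx_suml.
apply: eq_bigr => j _; rewrite -!mulmxA; congr (_ *m _).
have [f [f_unit fA /eqmxP SfE]] := S_copies j.
have /submxP [D ->] : (coordinate_block K m j <= S *m f)%MS by rewrite SfE.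
by rewrite -!(mulmxA D) -fA // -S_z // Sa.
Qed.

(** The c_h are the coordinates of e b in the basis e a_h. Commutativity gives e a_h b = e b a_h, so
    b and the combination agree on this basis of block i; faithfulness concludes. *)
Lemma commutative_span (i : 'I_l) (e : 'rV[K]_m) (a : 'I_m -> 'M[K]_(l * m)) :
  is_commutative A -> (forall h, A (a h)) ->
  (\matrix_h (e *m block_action i (a h))) \in unitmx ->
  forall b, A b -> exists c : 'I_m -> K, b = \sum_h c h *: a h.
Proof.
move=> A_comm Aa; set W := \matrix_h _ => W_unit b Ab.
pose c := e *m block_action i b *m invmx W; exists (fun h => c 0 h).
apply: (block_action_faithful (i := i)) => //; apply: (can_inj (mulKmx W_unit)).
apply/row_matrixP => h; rewrite !row_mul !rowK.
have comm x y : A x -> A y ->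
    e *m block_action i x *m block_action i y = e *m block_action i y *m block_action i x.
  move=> Ax Ay; have stable := coordinate_block_stable i.
  by rewrite -[LHS]mulmxA -block_actionM ?stable // (A_comm x y) // block_actionM ?stable // mulmxA.
rewrite comm // mulmx_sumr.
have -> : e *m block_action i b = \sum_h' c 0 h' *: (e *m block_action i (a h')).
  rewrite -[LHS](mulmxKV W_unit) mulmx_sum_row; apply: eq_bigr => h' _.
  by rewrite rowK.
rewrite mulmx_suml; apply: eq_bigr => h' _.
by rewrite -scalemxAl -scalemxAr comm.
Qed.

End SimpleModule.

(** * Generated submodules and base change *)

Section Submodules.
Variables (K : fieldType) (n : nat) (A : 'M[K]_n -> Prop).
Implicit Types R T : kalgebra K.

Definition row_span R p (b : 'M[R]_(p, n)) : vset n R := fun x => exists c, x = c *m b.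

Lemma submodule_sum R (M : vset n R) (I : finType) (r : I -> R) (x : I -> 'rV[R]_n) :
  is_submodule M -> (forall h, M (x h)) -> M (\sum_h r h *: x h).
Proof.
by case=> M0 MD MZ Mx; apply: big_ind => [|y z My Mz|h _]; [|exact: MD|exact: MZ].
Qed.

Lemma submodule_opp R (M : vset n R) x : is_submodule M -> M x -> M (- x).
Proof. by case=> _ _ MZ Mx; rewrite -scaleN1r; apply: MZ. Qed.

Lemma row_span_submodule R p (b : 'M[R]_(p, n)) : is_submodule (row_span b).
Proof.
split=> [|_ _ [c ->] [d ->]|r _ [c ->]]; first by exists 0; rewrite mul0mx.
  by exists (c + d); rewrite mulmxDl.
by exists (r *: c); rewrite scalemxAl.
Qed.

Lemma row_span_row R p (b : 'M[R]_(p, n)) h : row_span b (row h b).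
Proof. by exists (delta_mx 0 h); rewrite rowE. Qed.

Lemma row_span_rows R p q (b : 'M[R]_(p, n)) (x : 'M[R]_(q, n)) :
  (forall h, row_span b (row h x)) -> exists c, x = c *m b.
Proof.
move=> /fin_all_exists [c cE]; exists (\matrix_h c h).
by apply/row_matrixP => h; rewrite row_mul rowK cE.
Qed.

Lemma generated_submodule R (v : 'rV[R]_n) : is_submodule (generated A v).
Proof.
split=> [|x y gx gy|r x gx] M M_sub M_inv Mv; have [M0 MD MZ] := M_sub => //.
  by apply: MD; [exact: gx|exact: gy].
by apply: MZ; exact: gx.
Qed.

Lemma generated_invariant R (v : 'rV[R]_n) : Defs.invariant A (generated A v).
Proof. by move=> a x Aa gx M M_sub M_inv Mv; exact: M_inv Aa (gx M M_sub M_inv Mv). Qed.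

Lemma mem_generated R (v : 'rV[R]_n) : generated A v v.
Proof. by []. Qed.

Lemma ext_map R T (f : khom R T) p q (a : 'M[K]_(p, q)) :
  map_mx f (scalar_mx_ext R a) = scalar_mx_ext T a.
Proof. by apply/matrixP => i j; rewrite !mxE khom_scalar. Qed.

Lemma pullback_submodule R T (f : khom R T) (M : vset n R) :
  is_submodule (pullback f M).
Proof.
split=> [|_ _ [p [t [x [Mx ->]]]] [q [u [y [My ->]]]]|r _ [p [t [x [Mx ->]]]]].
- by exists 0%N, (fun=> 0), (fun=> 0); split=> [[]|] //; rewrite big_ord0.
- exists (p + q)%N, (fun h => match split h with inl a => t a | inr a => u a end),
    (fun h => match split h with inl a => x a | inr a => y a end).
  split=> [h|]; first by case: (split h).
  rewrite big_split_ord; congr (_ + _); apply: eq_bigr => h _.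
    by rewrite (unsplitK (inl h)).
  by rewrite (unsplitK (inr h)).
- exists p, (fun h => r * t h), x; split=> //.
  by rewrite scaler_sumr; apply: eq_bigr => h _; rewrite scalerA.
Qed.

Lemma mem_pullback R T (f : khom R T) (M : vset n R) x :
  M x -> pullback f M (map_mx f x).
Proof.
by move=> Mx; exists 1%N, (fun=> 1), (fun=> x); rewrite big_ord1 scale1r.
Qed.

Lemma pullback_min R T (f : khom R T) (M : vset n R) (N : vset n T) :
  is_submodule N -> (forall x, M x -> N (map_mx f x)) ->
  forall y, pullback f M y -> N y.
Proof.
by move=> N_sub MN _ [p [t [x [Mx ->]]]]; apply: submodule_sum => // h; apply: MN.
Qed.

Lemma pullback_invariant R T (f : khom R T) (M : vset n R) :
  Defs.invariant A M -> Defs.invariant A (pullback f M).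
Proof.
move=> M_inv a _ Aa [p [t [x [Mx ->]]]].
exists p, t, (fun h => x h *m scalar_mx_ext R a); split=> [h|]; first exact: M_inv.
rewrite mulmx_suml; apply: eq_bigr => h _.
by rewrite -scalemxAl map_mxM ext_map.
Qed.

Lemma pullback_row_span R T (f : khom R T) (M : vset n R) p (b : 'M[R]_(p, n)) :
  eq_vset M (row_span b) -> eq_vset (pullback f M) (row_span (map_mx f b)).
Proof.
move=> Mb y; split=> [|[c ->]].
  apply: pullback_min; first exact: row_span_submodule.
  by move=> x /Mb [c ->]; exists (map_mx f c); rewrite map_mxM.
exists p, (c 0), (fun h => row h b); split=> [h|]; first exact/Mb/row_span_row.
by rewrite mulmx_sum_row; apply: eq_bigr => h _; rewrite map_row.
Qed.

Lemma generated_pullback R T (f : khom R T) (v : 'rV[R]_n) :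
  eq_vset (generated A (map_mx f v)) (pullback f (generated A v)).
Proof.
move=> y; split=> [|]; first apply.
- exact: pullback_submodule.
- by apply: pullback_invariant; apply: generated_invariant.
- by apply: mem_pullback; apply: mem_generated.
apply: pullback_min; first exact: generated_submodule.
(* The vectors whose image under f lies in the submodule generated by f(v) form an invariant
   submodule containing v. *)
move=> x /(_ (fun z => generated A (map_mx f v) (map_mx f z))); apply.
- have [g0 gD gZ] := generated_submodule (map_mx f v).
  split=> [|a b ga gb|r a ga]; rewrite ?raddf0 ?map_mxD ?map_mxZ //; [exact: gD|exact: gZ].
- move=> a z Aa gz; rewrite map_mxM ext_map; exact: generated_invariant.
- exact: mem_generated.
Qed.

End Submodules.

(** * Points of the affine space as vectors with prescribed block i *)

Section FreeCoordinates.
Variables (K : fieldType) (l m : nat) (i : 'I_l).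
Hypothesis m_gt0 : (0 < m)%N.
Notation N := (l * m - m)%N.

Definition first_basis_row : 'rV[K]_m := \row_h (h == 0 :> nat)%N%:R.

Lemma first_basis_row_neq0 : first_basis_row != 0.
Proof.
apply/eqP => /rowP /(_ (Ordinal m_gt0)); rewrite !mxE eqxx => /eqP.
by rewrite oner_eq0.
Qed.

Lemma Phi_vector_block (R : kalgebra K) (psi : khom (polynomial_algebra K N) R) :
  colsub (block_index i) (Phi_vector i psi) = scalar_mx_ext R first_basis_row.
Proof.
apply/rowP => h; rewrite [LHS]mxE [LHS]mxE block_index_div block_index_mod eqxx !mxE.
by rewrite rmorph_nat.
Qed.

Lemma free_index_proof (j : 'I_N) : ((if j < i * m then j : nat else j + m) < l * m)%N.
Proof.
case: ifP => _; first by apply: leq_trans (ltn_ord j) (leq_subr _ _).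
by have := ltn_ord j; rewrite ltn_subRL addnC.
Qed.

(** The coordinate that carries variable j: inverse to the index shift in [Phi_vector]. *)
Definition free_index (j : 'I_N) : 'I_(l * m) := Ordinal (free_index_proof j).

Lemma Phi_vector_free_index (R : kalgebra K) (psi : khom (polynomial_algebra K N) R) j :
  Phi_vector i psi 0 (free_index j) = psi 'X_j.
Proof.
rewrite mxE /=.
have -> : ((if j < i * m then j : nat else j + m) %/ m == i)%N = false.
  apply/negbTE; case: ltnP => j_i; first by rewrite neq_ltn ltn_divLR // j_i.
  by rewrite neq_ltn orbC leq_divRL // mulSn addnC leq_add2r j_i.
have -> : (if (if j < i * m then j : nat else j + m) < i * m
    then (if j < i * m then j : nat else j + m)
    else (if j < i * m then j : nat else j + m) - m)%N = j.
  case: (ltnP j (i * m)) => j_i; first by rewrite j_i.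
  by rewrite ltnNge (leq_trans j_i (leq_addr _ _)) /= addnK.
by rewrite /polyvar valK.
Qed.

Lemma free_indexP (c : 'I_(l * m)) : (c %/ m)%N != i -> exists j, c = free_index j.
Proof.
move=> c_i; have [c_lt|c_ge] := ltnP c (i * m).
  (* As i <= l - 1, one has i m <= l m - m. *)
  have c_N : (c < N)%N.
    apply: leq_trans c_lt _; rewrite -[X in (_ - X)%N]mul1n -mulnBl leq_mul2r.
    by rewrite leq_subRL ?add1n ?ltn_ord ?orbT // (leq_trans _ (ltn_ord i)).
  by exists (Ordinal c_N); apply: val_inj; rewrite /= c_lt.
have c_ge' : (i * m + m <= c)%N.
  by rewrite addnC -mulSn -leq_divRL // ltn_neqAle eq_sym c_i leq_divRL.
have m_le : (m <= c)%N by apply: leq_trans c_ge'; exact: leq_addl.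
have c_N : (c - m < N)%N by rewrite ltn_sub2r // (leq_ltn_trans m_le).
exists (Ordinal c_N); apply: val_inj => /=.
by rewrite ltnNge leq_subRL // addnC c_ge' /= subnK.
Qed.

Lemma Phi_vector_inj (R : kalgebra K) (psi psi' : khom (polynomial_algebra K N) R) :
  Phi_vector i psi = Phi_vector i psi' -> psi =1 psi'.
Proof.
by move=> e; apply: khom_mpoly_eq => j; rewrite -!Phi_vector_free_index e.
Qed.

(** Together with [Phi_vector_inj], this parametrizes the vectors with first basis row in block i:
    their other coordinates are free values of the variables. *)
Lemma Phi_vector_surj (R : kalgebra K) (v : 'rV[R]_(l * m)) :
  colsub (block_index i) v = scalar_mx_ext R first_basis_row ->
  exists psi, Phi_vector i psi = v.
Proof.
move=> v_block; have [psi psiE] := mpoly_eval_exists (fun j => v 0 (free_index j)).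
exists psi; apply/rowP => c.
have [c_i|/free_indexP [j ->]] := eqVneq (c %/ m)%N (i : nat); last first.
  by rewrite Phi_vector_free_index psiE.
have [j [h cE]] := block_indexP c.
have ji : j = i by apply: val_inj; rewrite /= -(block_index_div j h) -cE.
have := Phi_vector_block psi; rewrite -v_block => /rowP /(_ h).
by rewrite [LHS]mxE [RHS]mxE cE ji.
Qed.

Lemma Phi_vector_comp (R T : kalgebra K) (psi : khom (polynomial_algebra K N) R)
    (g : khom R T) :
  Phi_vector i (khom_comp g psi) = map_mx g (Phi_vector i psi).
Proof.
apply/rowP => c; rewrite !mxE; case: ifP => // _; by rewrite rmorph_nat.
Qed.

End FreeCoordinates.

(** The value of a natural transformation at the identity of R is the universal submodule, from
    which its other values are pulled back. *)
Lemma khom_id_exists (K : fieldType) (R : kalgebra K) :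
  exists f : khom R R, f =1 id.
Proof.
by exists (@KHom K R R (GRing.RMorphism.clone _ _ idfun _) (fun=> erefl)).
Qed.

(** * Projection of invariant submodules onto block i *)

Section BlockProjection.
Variables (K : fieldType) (l m : nat) (A : 'M[K]_(l * m) -> Prop) (i : 'I_l).
Hypothesis A_stable : forall b j, A b -> stablemx (coordinate_block K m j) b.
Variable a : 'I_m -> 'M[K]_(l * m).
Hypothesis Aa : forall h, A (a h).
Let W : 'M[K]_m := \matrix_h (first_basis_row K m *m block_action i (a h)).
Hypothesis W_unit : W \in unitmx.
Implicit Types R T : kalgebra K.
Notation block := (colsub (block_index i)).
Notation e0 R := (scalar_mx_ext R (first_basis_row K m)).

Definition orbit_mx R (v : 'rV[R]_(l * m)) : 'M[R]_(m, l * m) :=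
  \matrix_h (v *m scalar_mx_ext R (a h)).

Lemma ext_invmxK R p (x : 'M[R]_(p, m)) :
  x *m scalar_mx_ext R (invmx W) *m scalar_mx_ext R W = x.
Proof. by rewrite -mulmxA -map_mxM mulVmx // map_mx1 mulmx1. Qed.

Lemma ext_mxK R p (x : 'M[R]_(p, m)) :
  x *m scalar_mx_ext R W *m scalar_mx_ext R (invmx W) = x.
Proof. by rewrite -mulmxA -map_mxM mulmxV // map_mx1 mulmx1. Qed.

Lemma orbit_mx_block R v : block v = e0 R -> block (orbit_mx v) = scalar_mx_ext R W.
Proof.
move=> v_block; apply/row_matrixP => h.
have -> : row h (block (orbit_mx v)) = block (v *m scalar_mx_ext R (a h)).
  by apply/rowP => c; rewrite !mxE.
rewrite ext_block_mul => [|j]; last exact: A_stable.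
by rewrite v_block -map_mxM -map_row rowK.
Qed.

(** The vectors v a_h lie in M and project to the rows of W, whose inverse over K remains an inverse
    over R. *)
Lemma block_lift R (M : vset (l * m) R) v (x : 'rV[R]_m) :
  is_submodule M -> Defs.invariant A M -> M v -> block v = e0 R ->
  exists2 y, M y & block y = x.
Proof.
move=> M_sub M_inv Mv v_block.
exists (x *m scalar_mx_ext R (invmx W) *m orbit_mx v); last first.
  by rewrite -mulmx_colsub orbit_mx_block // ext_invmxK.
have Mr h : M (row h (orbit_mx v)) by rewrite rowK; apply: M_inv.
rewrite mulmx_sum_row; exact: submodule_sum.
Qed.

Lemma block_inverse R (M : vset (l * m) R) (b : 'M[R]_(m, l * m)) v :
  eq_vset M (row_span b) -> Defs.invariant A M -> M v -> block v = e0 R ->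
  exists C, C *m block b = 1%:M.
Proof.
move=> Mb M_inv Mv v_block.
have M_sub : is_submodule M.
  have [s0 sD sZ] := row_span_submodule b.
  by split=> [|x y /Mb sx /Mb sy|r x /Mb sx]; apply/Mb; [|exact: sD|exact: sZ].
have /fin_all_exists [y yP] : forall h : 'I_m, exists y : 'rV[R]_(l * m),
    row_span b y /\ block y = row h 1%:M.
  move=> h; have [y My yE] := block_lift (row h 1%:M) M_sub M_inv Mv v_block.
  by exists y; split=> //; apply/Mb.
have [h|C CE] := @row_span_rows _ _ _ _ _ b (\matrix_h y h).
  by rewrite rowK; case: (yP h).
exists C; rewrite mulmx_colsub -CE; apply/row_matrixP => h.
have [_ <-] := yP h; apply/rowP => c; by rewrite !mxE.
Qed.

(** A one-sided inverse of a square matrix over a commutative ring is two-sided, so the coefficients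
    of x can be recovered from its block. *)
Lemma block_injective R (b : 'M[R]_(m, l * m)) C x :
  C *m block b = 1%:M -> row_span b x -> block x = 0 -> x = 0.
Proof.
move=> /mulmx1C bC [c ->]; rewrite -mulmx_colsub => cb0.
by rewrite -[c]mulmx1 -bC mulmxA cb0 !mul0mx.
Qed.

(** The submodule generated by v already surjects onto block i; where the projection is injective on
    M, nothing more fits in M. *)
Lemma generated_eq R (M : vset (l * m) R) v :
  is_submodule M -> Defs.invariant A M -> M v -> block v = e0 R ->
  (forall x, M x -> block x = 0 -> x = 0) -> eq_vset (generated A v) M.
Proof.
move=> M_sub M_inv Mv v_block M_inj x; split=> [|Mx]; first by apply.
have [y gy yx] := block_lift (block x) (generated_submodule A v)
  (@generated_invariant _ _ A _ v) (@mem_generated _ _ A _ v) v_block.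
suff -> : x = y by [].
have [_ MD _] := M_sub; apply/eqP; rewrite -subr_eq0; apply/eqP/M_inj.
  by apply: MD => //; apply: submodule_opp => //; apply: gy.
by rewrite raddfB /= yx subrr.
Qed.

(** * The open locus and its ideal *)

Section Openness.
Hypothesis m_gt0 : (0 < m)%N.
Notation B := (polynomial_algebra K (l * m - m)).

(** Both generating vectors lie in the same submodule and have the same block i, on which the
    projection is injective. *)
Lemma Phi_injective R (psi psi' : khom B R) :
  F_ A m (Phi_ A i psi) -> eq_vset (Phi_ A i psi) (Phi_ A i psi') -> psi =1 psi'.
Proof.
move=> [[_ [b [Mb _]] _] M_inv] e; apply: (Phi_vector_inj (i := i) m_gt0).
have [C CE] := block_inverse Mb M_inv (@mem_generated _ _ A _ _) (Phi_vector_block i psi).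
apply/eqP; rewrite -subr_eq0; apply/eqP/(block_injective CE).
  apply/Mb; have [_ MD _] := generated_submodule A (Phi_vector i psi).
  apply: MD; first exact: mem_generated.
  apply: (submodule_opp (generated_submodule A _)).
  by apply/e; exact: mem_generated.
by rewrite raddfB /= !Phi_vector_block subrr.
Qed.

Lemma Phi_natural (R T : kalgebra K) (psi : khom B R) (g : khom R T) :
  eq_vset (Phi_ A i (khom_comp g psi)) (pullback g (Phi_ A i psi)).
Proof. by rewrite /Phi_ Phi_vector_comp; exact: generated_pullback. Qed.

Lemma Phi_open (R : kalgebra K) (eta : forall T, khom R T -> vset (l * m) T) :
  natural_transformation (F_ A m) eta ->
  exists I : R -> Prop, is_ideal I /\
    forall T (d : khom R T),
      (exists psi : khom B T, eq_vset (Phi_ A i psi) (eta T d)) <->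
      extends_to_unit_ideal d I.
Proof.
move=> [eta_F eta_nat]; have [f_id f_idE] := khom_id_exists R.
have [[_ [b [Mb _]] _] _] := eta_F R f_id.
pose D := \det (block b).
exists (fun r => exists s, r = s * D); split.
  split=> [|_ _ [s ->] [t ->]|r _ [s ->]]; first by exists 0; rewrite mul0r.
    by exists (s + t); rewrite mulrDl.
  by exists (r * s); rewrite mulrA.
(* By naturality at the universal point, [eta T d] is spanned by the image of b under d. *)
move=> T d; have eta_b : eq_vset (eta T d) (row_span (map_mx d b)).
  have comp_id : khom_comp d f_id = d by apply: khom_eq => x /=; rewrite f_idE.
  move=> y; rewrite -{1}comp_id; apply: iff_trans (eta_nat _ _ _ _ y) _.
  exact: (pullback_row_span d Mb).
have [[eta_sub _ _] eta_inv] := eta_F T d.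
have det_b : \det (block (map_mx d b)) = d D by rewrite -map_mxsub det_map_mx.
split=> [[psi psiE] y|unit_I].
  have [||C CE] := block_inverse (v := Phi_vector i psi) eta_b eta_inv.
  - by apply/psiE; exact: mem_generated.
  - exact: Phi_vector_block.
  (* The relation det C * d D = 1 writes any y as a multiple of d D. *)
  exists 1%N, (fun=> y * \det C), (fun=> D); split=> [_|].
    by exists 1; rewrite mul1r.
  by rewrite big_ord1 -mulrA -det_b -det_mulmx CE det1 mulr1.
(* Writing 1 with multiples of D exhibits an inverse u of d D; the adjugate then inverts block i,
   and v is the vector of [eta T d] whose block i is the first basis row. *)
have [p [t [r [/fin_all_exists [s rE] sum1]]]] := unit_I 1.
pose u := \sum_j t j * d (s j).
have uD : u * d D = 1.
  by rewrite sum1 mulr_suml; apply: eq_bigr => j _; rewrite rE rmorphM mulrA.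
pose C := u *: \adj (block (map_mx d b)).
have CE : C *m block (map_mx d b) = 1%:M.
  by rewrite -scalemxAl mul_adj_mx det_b scale_scalar_mx uD.
pose v := e0 T *m C *m map_mx d b.
have v_block : block v = e0 T by rewrite -mulmx_colsub -mulmxA CE mulmx1.
have [psi psiE] := Phi_vector_surj m_gt0 v_block.
exists psi; rewrite /Phi_ psiE; apply: generated_eq => //.
  by apply/eta_b; exists (e0 T *m C).
by move=> x /eta_b; exact: block_injective CE.
Qed.

End Openness.

(** * Generated submodules when the a_h span A *)

Section Commutative.
Hypothesis A1 : A 1%:M.
Hypothesis AM : forall b c, A b -> A c -> A (b *m c).
Hypothesis A_span : forall b, A b -> exists c : 'I_m -> K, b = \sum_h c h *: a h.

Lemma orbit_mx_span R (v : 'rV[R]_(l * m)) b :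
  A b -> row_span (orbit_mx v) (v *m scalar_mx_ext R b).
Proof.
move=> /A_span [c ->].
have -> : v *m scalar_mx_ext R (\sum_h c h *: a h) =
    \sum_h kalg_scalar R (c h) *: row h (orbit_mx v).
  rewrite /scalar_mx_ext raddf_sum mulmx_sumr; apply: eq_bigr => h _.
  by rewrite /= map_mxZ -scalemxAr rowK.
apply: submodule_sum => [|h]; [exact: row_span_submodule|exact: row_span_row].
Qed.

(** The span of the v a_h is invariant because each product a_h b expands again in the a_h, and it
    contains v because 1 does. *)
Lemma generated_span R (v : 'rV[R]_(l * m)) :
  eq_vset (generated A v) (row_span (orbit_mx v)).
Proof.
move=> x; split=> [|[c ->] M M_sub M_inv Mv]; first apply.
- exact: row_span_submodule.
- move=> b _ Ab [c ->]; rewrite -mulmxA mulmx_sum_row.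
  apply: submodule_sum => [|h]; first exact: row_span_submodule.
  by rewrite row_mul rowK -mulmxA -map_mxM; apply: orbit_mx_span; apply: AM.
- by have := orbit_mx_span v A1; rewrite /scalar_mx_ext map_mx1 mulmx1.
rewrite mulmx_sum_row; apply: submodule_sum => // h; rewrite rowK; exact: M_inv.
Qed.

Lemma generated_F R (v : 'rV[R]_(l * m)) : block v = e0 R -> F_ A m (generated A v).
Proof.
move=> v_block; have spanE := generated_span v.
have orbit_inj c : block (c *m orbit_mx v) = 0 -> c = 0.
  rewrite -mulmx_colsub orbit_mx_block // => cW.
  by rewrite -[c]ext_mxK cW mul0mx.
split; last exact: generated_invariant.
split; first exact: generated_submodule.
  exists (orbit_mx v); split=> [|c c0]; first exact: spanE.
  by apply: orbit_inj; rewrite c0 raddf0.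
(* The complement is the kernel of the projection onto block i. *)
exists (fun x => block x = 0); split.
- split=> [|x y x0 y0|r x x0]; first exact: raddf0.
    by rewrite raddfD /= x0 y0 addr0.
  by apply/rowP => h; have /rowP /(_ h) := x0; rewrite !mxE => ->; rewrite mulr0.
- move=> x; have [y gy yx] := block_lift (block x) (generated_submodule A v)
    (@generated_invariant _ _ A _ v) (@mem_generated _ _ A _ v) v_block.
  exists y, (x - y); split=> //; last by rewrite addrC subrK.
  by rewrite raddfB /= yx subrr.
- by move=> x /spanE [c ->] /orbit_inj ->; rewrite mul0mx.
Qed.

End Commutative.

End BlockProjection.

(** * Interpolation and expansion of exterior products *)

Lemma infinite_injection (K : fieldType) d :
  is_infinite K -> exists t : 'I_d -> K, injective t.
Proof.
move=> K_inf.
suff [s s_uniq s_size] : exists2 s : seq K, uniq s & size s = d.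
  exists (fun u => nth 0 s u) => u u' /eqP.
  by rewrite nth_uniq ?s_size // => /eqP /val_inj.
elim: d => [|d [s s_uniq s_size]]; first by exists [::].
have [x x_s] := K_inf s; exists (x :: s); by rewrite /= ?x_s ?s_size.
Qed.

(** L u is the value at y of the Lagrange polynomial of node t u, whose coefficients form a row of
    the inverse Vandermonde matrix. *)
Lemma interpolate_powers (K : fieldType) d (t : 'I_d -> K) (R : kalgebra K) (y : R) :
  injective t -> exists L : 'I_d -> R,
    forall e, (e < d)%N -> y ^+ e = \sum_u L u * kalg_scalar R (t u) ^+ e.
Proof.
move=> t_inj; pose V : 'M[K]_d := Vandermonde d (\row_u t u).
have V_unit : V \in unitmx.
  rewrite unitmxE unitfE det_Vandermonde.
  apply/prodf_neq0 => u _; apply/prodf_neq0 => u' uu'.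
  by rewrite !mxE subr_eq0 (inj_eq t_inj); apply: contraTneq uu' => ->; rewrite ltnn.
exists (fun u => \sum_e' kalg_scalar R (invmx V u e') * y ^+ e') => e e_d.
have VV e' : \sum_u kalg_scalar R (invmx V u e') * kalg_scalar R (t u) ^+ e =
    (Ordinal e_d == e')%:R.
  have := congr1 (fun M : 'M_d => kalg_scalar R (M (Ordinal e_d) e')) (mulmxV V_unit).
  rewrite !mxE rmorph_nat rmorph_sum => <-; apply: eq_bigr => u _.
  by rewrite rmorphM /= !mxE rmorphXn mulrC.
under eq_bigr do rewrite mulr_suml.
rewrite exchange_big /=.
under eq_bigr => e' _.
  under eq_bigr do rewrite mulrAC.
  rewrite -mulr_suml VV; over.
rewrite (bigD1 (Ordinal e_d)) //= eqxx mul1r big1 ?addr0 // => e' ee'.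
by rewrite eq_sym (negPf ee') mul0r.
Qed.

Lemma prod_fiber (R : comPzRingType) (I J : finType) (g : I -> J) (F : J -> R) :
  \prod_h F (g h) = \prod_c F c ^+ #|[pred h | g h == c]|.
Proof.
rewrite (partition_big g xpredT) //=; apply: eq_bigr => c _.
rewrite -prodr_const; by apply: eq_big => [h|h /eqP ->].
Qed.

(** A monomial of degree m has exponent at most m in each coordinate, so one interpolates coordinate
    by coordinate and expands. The weights do not depend on g: one grid serves all monomials. *)
Lemma interpolate_products (R : comPzRingType) m n d (v : 'I_n -> R)
    (L t : 'I_n -> 'I_d -> R) :
  (forall c e, (e <= m)%N -> v c ^+ e = \sum_u L c u * t c u ^+ e) ->
  forall g : 'I_m -> 'I_n, \prod_h v (g h) =
    \sum_(u : {ffun 'I_n -> 'I_d}) (\prod_c L c (u c)) * \prod_h t (g h) (u (g h)).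
Proof.
move=> vE g; rewrite prod_fiber.
under eq_bigr => c _.
  rewrite vE; last by rewrite -[X in (_ <= X)%N]card_ord max_card.
  over.
rewrite bigA_distr_bigA; apply: eq_bigr => u _.
by rewrite big_split (prod_fiber g (fun c => t c (u c))).
Qed.

(** Multilinearity in the rows exhibits the determinant as a combination of monomials of degree m in
    the coordinates of v, with coefficients independent of v. *)
Lemma det_linear_rows (R : comPzRingType) m n (v : 'rV[R]_n) (b : 'I_m -> 'M[R]_(n, m)) :
  \det (\matrix_h (v *m b h)) = \sum_(g : {ffun 'I_m -> 'I_n})
    (\prod_h v 0 (g h)) * \det (\matrix_(h, j) b h (g h) j).
Proof.
rewrite /determinant.
under [RHS]eq_bigr do rewrite mulr_sumr.
rewrite exchange_big; apply: eq_bigr => s _ /=.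
under [X in _ * X]eq_bigr do rewrite !mxE.
rewrite bigA_distr_bigA mulr_sumr; apply: eq_bigr => g _.
rewrite big_split mulrCA; congr (_ * (_ * _)).
by apply: eq_bigr => h _; rewrite mxE.
Qed.

(** Any m vectors of M are the rows of some C b, whose maximal minors are det C times those of b. *)
Lemma in_wedge_image_span (K : fieldType) n m (R : kalgebra K) (M : vset n R)
    (b : 'M[R]_(m, n)) (w : increasing n m -> R) :
  eq_vset M (row_span b) ->
  in_wedge_image M w <-> exists c, forall J, w J = c * wedge b J.
Proof.
move=> Mb; split=> [[p [r [x [Mx wE]]]]|[c wE]]; last first.
  exists 1%N, (fun=> c), (fun=> b); split=> [_ h|J]; first exact/Mb/row_span_row.
  by rewrite big_ord1.
have /fin_all_exists [C CE] : forall j, exists C, x j = C *m b.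
  by move=> j; apply: row_span_rows => h; apply/Mb.
exists (\sum_j r j * \det (C j)) => J; rewrite wE mulr_suml.
by apply: eq_bigr => j _; rewrite CE /wedge -mulmx_colsub det_mulmx mulrA.
Qed.

(** * Exterior products as combinations of invariant ones *)

Section GeneratedByInvariants.
Variables (K : fieldType) (l m : nat) (A : 'M[K]_(l * m) -> Prop) (i : 'I_l).
Hypothesis A_stable : forall b j, A b -> stablemx (coordinate_block K m j) b.
Variable a : 'I_m -> 'M[K]_(l * m).
Hypothesis Aa : forall h, A (a h).
Hypothesis W_unit :
  (\matrix_h (first_basis_row K m *m block_action i (a h))) \in unitmx.
Hypothesis A1 : A 1%:M.
Hypothesis AM : forall b c, A b -> A c -> A (b *m c).
Hypothesis A_span : forall b, A b -> exists c : 'I_m -> K, b = \sum_h c h *: a h.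

(** Projecting the t a_h to block i gives the invertible W, whence independence; expanding a_h b in
    the a_h gives stability. *)
Lemma invariant_basis_orbit (t : 'rV[K]_(l * m)) :
  t *m (coordinate_block K m i)^T = first_basis_row K m ->
  invariant_basis A (\matrix_h (t *m a h)).
Proof.
move=> t_block; split.
  apply/row_freeP; exists ((coordinate_block K m i)^T *m
    invmx (\matrix_h (first_basis_row K m *m block_action i (a h)))).
  rewrite mulmxA -[RHS](mulmxV W_unit); congr (_ *m _); apply/row_matrixP => h.
  rewrite row_mul !rowK -mulmxA block_diagonal_mul ?mulmxA ?t_block // => j.
  exact: A_stable.
move=> b Ab; apply/row_subP => h; rewrite row_mul rowK -mulmxA.
have [c ->] := A_span (AM (Aa h) Ab); rewrite mulmx_sumr.
apply: summx_sub => h' _; rewrite -scalemxAr; apply: scalemx_sub.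
by rewrite -[t *m a h'](rowK (fun h => t *m a h)) row_sub.
Qed.

Lemma generated_G (R : kalgebra K) (v : 'rV[R]_(l * m)) :
  is_infinite K ->
  colsub (block_index i) v = scalar_mx_ext R (first_basis_row K m) ->
  G_ A m (generated A v).
Proof.
move=> K_inf v_block; split.
  by case: (generated_F A_stable Aa W_unit A1 AM A_span v_block).
(* Exponents range from 0 to m, which takes m + 1 nodes. *)
have [t t_inj] := infinite_injection m.+1 K_inf.
pose e0 c : K := (c %% m == 0)%N%:R.
(* In block [i], where [v] is constant, a single node is used, so that all nodes [s] stay
   in the affine space of vectors with first basis row in block [i]. *)
have /fin_all_exists [sL sLE] : forall c : 'I_(l * m),
    exists sL : ('I_m.+1 -> K) * ('I_m.+1 -> R),
    (forall e, (e <= m)%N ->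
      v 0 c ^+ e = \sum_u sL.2 u * kalg_scalar R (sL.1 u) ^+ e) /\
    ((c %/ m)%N = i -> forall u, sL.1 u = e0 c).
  move=> c; have [c_i|c_i] := eqVneq (c %/ m)%N (i : nat); last first.
    have [L LE] := interpolate_powers (v 0 c) t_inj.
    by exists (t, L); split=> // /eqP; rewrite (negPf c_i).
  exists (fun=> e0 c, fun u => (u == ord0)%:R); split=> // e _ /=.
  rewrite (bigD1 ord0) //= big1 => [|u /negPf ->]; last by rewrite mul0r.
  rewrite mul1r addr0; congr (_ ^+ _).
  have [j [h cE]] := block_indexP c.
  have ji : j = i by apply: val_inj; rewrite /= -(block_index_div j h) -cE.
  have /rowP /(_ h) := v_block; rewrite !mxE -ji -cE => ->.
  by rewrite /e0 cE block_index_mod.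
pose U := {ffun 'I_(l * m) -> 'I_m.+1}.
pose s (u : U) : 'rV[K]_(l * m) := \row_c (sL c).1 (u c).
have s_block u : s u *m (coordinate_block K m i)^T = first_basis_row K m.
  apply/rowP => h; rewrite mxE (bigD1 (block_index i h)) //= big1 => [|c].
    rewrite !mxE eqxx mulr1 addr0; have [_ ->] := sLE (block_index i h).
      by rewrite /e0 block_index_mod.
    exact: block_index_div.
  by rewrite !mxE -val_eqE /= => /negPf ->; rewrite mulr0.
(* The grid is enumerated because [generated_by_invariants] asks for a family indexed by an
   ordinal. *)
pose node (j : 'I_#|U|) : U := enum_val j.
exists #|U|, (fun j => \prod_c (sL c).2 (node j c)),
  (fun j => \matrix_h (s (node j) *m a h)).
split=> [j|w]; first exact: invariant_basis_orbit.
have wedgeE J : wedge (orbit_mx a v) J =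
    \sum_(j < #|U|) (\prod_c (sL c).2 (node j c)) *
      wedge (scalar_mx_ext R (\matrix_h (s (node j) *m a h))) J.
  pose F (u : U) := (\prod_c (sL c).2 (u c)) *
      wedge (scalar_mx_ext R (\matrix_h (s u *m a h))) J.
  rewrite -(big_enum_val (A := U) F) /F /wedge.
  pose b h := colsub (val J) (scalar_mx_ext R (a h)).
  have colsubE (y : 'rV[R]_(l * m)) :
      colsub (val J) (\matrix_h (y *m scalar_mx_ext R (a h))) = \matrix_h (y *m b h).
    by apply/matrixP => h c; rewrite [RHS]mxE /b mulmx_colsub !mxE.
  have -> : \det (colsub (val J) (orbit_mx a v)) = \det (\matrix_h (v *m b h)).
    by rewrite -colsubE.
  rewrite det_linear_rows.
  have sE u : \det (colsub (val J) (scalar_mx_ext R (\matrix_h (s u *m a h)))) =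
      \det (\matrix_h (scalar_mx_ext R (s u) *m b h)).
    rewrite -colsubE; congr (\det (colsub _ _)); apply/row_matrixP => h.
    by rewrite rowK -map_row rowK map_mxM.
  under [RHS]eq_bigr do rewrite sE det_linear_rows mulr_sumr.
  (* For each monomial g, the weighted sum over the grid returns its value at v. *)
  rewrite exchange_big /=; apply: eq_bigr => g _.
  rewrite (interpolate_products (L := fun c => (sL c).2)
    (t := fun c u => kalg_scalar R ((sL c).1 u)) (fun c => (sLE c).1)).
  rewrite mulr_suml; apply: eq_bigr => u _; rewrite mulrA.
  by congr (_ * _ * _); apply: eq_bigr => h _; rewrite !mxE.
rewrite (in_wedge_image_span _ (generated_span Aa A1 AM A_span v)).
by split=> -[c wE]; exists c => J; rewrite wE wedgeE.
Qed.

End GeneratedByInvariants.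

(** For 2 x 2 matrices acting diagonally on K^4, the vector (e_1, e_2) generates a submodule of rank
    4 rather than 2. Thus values in [F_] are derived when A is commutative and assumed otherwise. *)
Theorem lemma4p6 (k K : fieldType) (iota : {rmorphism k -> K}) (l m : nat)
    (A : 'M[K]_(l * m) -> Prop) (S : 'M[K]_(l * m))
    (A_alg : is_subalgebra iota A)
    (S_simple : is_simple A S)
    (S_dim : \rank S = m)
    (S_copies : is_coordinate_sum_of_copies A S)
    (i : 'I_l) :
  ((is_commutative A \/
    (forall (R : kalgebra K) (psi : khom (polynomial_algebra K (l * m - m)) R),
      F_ A m (Phi_ A i psi))) ->
   open_subfunctor (F_ A m) (@Phi_ K l m A i)) /\
  (is_infinite K -> is_commutative A ->
   open_subfunctor (H_ A m) (@Phi_ K l m A i)).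
Proof.
have m_gt0 : (0 < m)%N.
  by case: S_simple => _ S_neq0 _; rewrite -S_dim lt0n mxrank_eq0.
have A_stable b (j : 'I_l) : A b -> stablemx (coordinate_block K m j) b.
  exact: (coordinate_block_stable S_simple S_copies).
have [a [Aa W_unit]] :=
  orbit_basis A_alg S_simple S_copies i (first_basis_row_neq0 K m_gt0).
have [A1 _ AM _] := A_alg.
have A_span (A_comm : is_commutative A) :=
  commutative_span S_simple S_copies A_comm Aa W_unit.
have Phi_F (A_comm : is_commutative A) (R : kalgebra K) psi : F_ A m (@Phi_ K l m A i R psi).
  exact (generated_F A_stable Aa W_unit A1 AM (A_span A_comm) (Phi_vector_block i psi)).
split=> [A_or|K_inf A_comm].
  have {}Phi_F R psi : F_ A m (@Phi_ K l m A i R psi).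
    by case: A_or => [A_comm|]; [exact: Phi_F|apply].
  split.
  - by split=> [R psi|R T psi g]; [exact: Phi_F|exact: Phi_natural].
  - by move=> R psi psi'; apply: (Phi_injective A_stable Aa W_unit m_gt0).
  - by move=> R eta; apply: (Phi_open A_stable Aa W_unit m_gt0).
split.
- split=> [R psi|R T psi g]; last exact: Phi_natural.
  split; first exact: Phi_F.
  exact: (generated_G A_stable Aa W_unit A1 AM (A_span A_comm) K_inf (Phi_vector_block i psi)).
- by move=> R psi psi'; apply: (Phi_injective A_stable Aa W_unit m_gt0); apply: Phi_F.
(* A transformation to [H_] is also one to [F_], so the same ideal works. *)
- move=> R eta [eta_H eta_nat]; apply: (Phi_open A_stable Aa W_unit m_gt0).
  by split=> // T d; case: (eta_H T d).
Qed.
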